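(* Let $\mathcal F_1,\dots,\mathcal F_{n+1}$ be families of $1$-convex compact sets in $\mathbb R^n$ such that any two sets belonging to the same family $\mathcal F_i$ have non-empty intersection. Then at least one of the following holds: 1) the family $\bigcup_{i=1}^{n+1}\mathcal F_i$ has a common hyperplane transversal, i.e. some hyperplane intersects every set in every $\mathcal F_i$; 2) for every partition of $\{1,\dots,n+1\}$ into non-empty sets $I_1,I_2$ there exist a hyperplane $h$ and representatives $C_i\in\mathcal F_i$ ($i=1,\dots,n+1$) such that the sets $C_i$, $i\in I_1$, lie on one side of $h$ and the sets $C_i$, $i\in I_2$, lie on the other side of $h$.
   Context: A set $X\subseteq\mathbb R^n$ is $1$-convex if its orthogonal projection onto every line through the origin is convex (a segment). *)

(* Defs.v *)
From HB Require Import structures.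
From mathcomp Require Import all_boot all_order all_algebra.
From mathcomp Require Import all_classical all_reals all_analysis.

Set Implicit Arguments.
Unset Strict Implicit.
Unset Printing Implicit Defensive.

Import Order.TTheory GRing.Theory Num.Theory.
Import numFieldNormedType.Exports.

Local Open Scope classical_set_scope.
Local Open Scope ring_scope.

(* Points of R^n are row vectors; their (sup-norm) topology is the usual one. *)

Definition dot (R : realType) (n : nat) (u v : 'rV[R]_n) : R :=
  \sum_(k < n) u 0 k * v 0 k.

(* Orthogonal projection onto the line R u; meaningful only for u != 0. *)
Definition line_proj (R : realType) (n : nat) (u x : 'rV[R]_n) : 'rV[R]_n :=
  (dot u x / dot u u) *: u.

(* The empty set satisfies this predicate: non-emptiness is required
   separately wherever it is needed. *)
Definition one_convex (R : realType) (n : nat) (X : set 'rV[R]_n) : Prop :=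
  forall u : 'rV[R]_n, u != 0 -> convex_set (line_proj u @` X).

(* For u != 0 this is a hyperplane, and all affine hyperplanes arise so; the
   next two sets are then the two (open) sides of it. *)
Definition hyperplane (R : realType) (n : nat) (u : 'rV[R]_n) (c : R) :
  set 'rV[R]_n := [set x | dot u x = c].

Definition pos_side (R : realType) (n : nat) (u : 'rV[R]_n) (c : R) :
  set 'rV[R]_n := [set x | c < dot u x].

Definition neg_side (R : realType) (n : nat) (u : 'rV[R]_n) (c : R) :
  set 'rV[R]_n := [set x | dot u x < c].

Definition common_transversal (R : realType) (n : nat)
    (u : 'rV[R]_n) (c : R) (G : set (set 'rV[R]_n)) : Prop :=
  forall C, G C -> hyperplane u c `&` C !=set0.

(* Members A and B are not assumed distinct, so all members are non-empty. *)
Definition pairwise_intersecting (R : realType) (n : nat)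
    (G : set (set 'rV[R]_n)) : Prop :=
  forall A B, G A -> G B -> A `&` B !=set0.

(* Main.v *)
(** Idea. Write [lo C u] and [hi C u] for the minimum and the maximum of
    [<u, x>] over [x] in [C]. By 1-convexity the hyperplane [<u, x> = c] meets [C]
    iff [lo C u <= c <= hi C u], so if there is no common transversal then in
    every direction [u] two members satisfy [hi D u < lo C u]; by compactness
    finitely many members suffice for all directions. Let [excess i u] be
    the largest of [0] and the numbers [lo C u - hi D u] with [C] in the [i]-th
    family and [D] in any family. The functions
    [balance i u := excess i u - excess i (- u)] are odd in [u]. Requiring the
    balance to be constant on [I1] and constant on [I2] amounts to [n - 1] odd
    equations on the sphere of dimension [n - 1], which have a solution by
    Borsuk-Ulam. If [C] is a member with highest [lo C u] and [D] one with lowest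
    [hi D u], then the balance is [lo C u - hi D u > 0] at the family of [C] and
    the opposite at the family of [D]. So these belong to different parts, and
    the two constant values force every family of one part to have a member as
    high as [C], and every family of the other a member as low as [D].

    Borsuk-Ulam is proved by dualizing the chain argument for Tucker's lemma, so
    that only cochains mod 2 occur, as boolean functions of tuples of points. For
    an antipodal labelling of the sphere, Ky Fan's cochains [fan b], counting the
    simplices with alternating labels of first sign [b], satisfy
    [cobd (fan true) = fan true + fan false]. Hence the value of [fan true] on the
    subdivided boundary of the cross-polytope is the same in all dimensions,
    namely [1]; but it vanishes when there are fewer labels than vertices. *)

Require Import Defs.
From HB Require Import structures.
From mathcomp Require Import all_boot all_order all_algebra.
From mathcomp Require Import all_classical all_reals all_analysis.
From mathcomp Require Import finmap.

Set Implicit Arguments.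
Unset Strict Implicit.
Unset Printing Implicit Defensive.

Import Order.TTheory GRing.Theory Num.Theory.
Import numFieldNormedType.Exports.

(** * Coboundaries mod 2 and alternating labels *)

Section Coboundary.
Variable T : Type.
Implicit Types (f g : seq T -> bool) (s : seq T).

Definition consf x f : seq T -> bool := fun s => f (x :: s).

(* The coboundary of the augmented complex: the empty tuple is the only simplex
   of dimension [-1]. *)
Fixpoint cobd f s : bool :=
  if s is x :: s' then f s' (+) cobd (consf x f) s' else false.

Lemma cobdD f g s : cobd (fun t => f t (+) g t) s = cobd f s (+) cobd g s.
Proof.
elim: s f g => //= x s IH f g.
by rewrite (IH (consf x f) (consf x g)) addbACA.
Qed.

Lemma cobd0 s : cobd (fun=> false) s = false.
Proof. by elim: s => //= x s ->. Qed.

Lemma cobd_cobd f s : cobd (cobd f) s = false.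
Proof.
elim: s f => //= x s IH f.
by rewrite (cobdD f (cobd (consf x f))) IH addbF addbb.
Qed.

End Coboundary.

Lemma cobd_map (T T' : Type) (h : T' -> T) (f : seq T -> bool) (s : seq T') :
  cobd (fun t => f (map h t)) s = cobd f (map h s).
Proof. by elim: s f => //= x s IH f; rewrite -IH. Qed.

Lemma eq_cobd (T : eqType) (f g : seq T -> bool) s :
  (forall t, subseq t s -> (size t).+1 = size s -> f t = g t) ->
  cobd f s = cobd g s.
Proof.
elim: s f g => //= x s IH f g fg; congr (_ (+) _).
  by apply: fg => //; exact: subseq_cons.
by apply: IH => t ts tz; apply: fg; rewrite /= ?eqxx// tz.
Qed.

Lemma cobd_rem (T : eqType) (f : seq T -> bool) s :
  (forall t t', perm_eq t t' -> f t = f t') ->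
  cobd f s = \big[addb/false]_(x <- s) f (rem x s).
Proof.
elim: s f => [|y s IH] f fP; first by rewrite big_nil.
rewrite big_cons /= eqxx IH; last first.
  by move=> t t' tt'; apply: fP; rewrite perm_cons.
congr (_ (+) _); rewrite big_seq [RHS]big_seq; apply: eq_bigr => x xs.
by case: eqP xs => // -> ys; apply/esym/fP/perm_to_rem.
Qed.

Lemma perm_cobd (T : eqType) (f : seq T -> bool) s s' :
  (forall t t', perm_eq t t' -> f t = f t') ->
  perm_eq s s' -> cobd f s = cobd f s'.
Proof.
move=> fP ss'; rewrite !cobd_rem// (perm_big _ ss') big_seq [RHS]big_seq.
apply: eq_bigr => x xs'; apply: fP; rewrite -(perm_cons x).
rewrite -(permPl (perm_to_rem _)) ?(perm_mem ss')//.
by rewrite (permPl ss') perm_to_rem.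
Qed.

Fixpoint alternates (b : bool) (s : seq bool) : bool :=
  if s is x :: s' then (x == b) && alternates (~~ b) s' else true.

(** An entry whose deletion leaves an alternating list is either an end of an alternating list or
    one of two equal neighbours; in the latter case the two deletions cancel. *)
Lemma cobd_alternates b s :
  cobd (alternates b) s = alternates b s (+) alternates (~~ b) s.
Proof.
elim: s b => //= x s IH b; rewrite negbK.
have [->|xb] := eqVneq x b.
  rewrite (@eq_cobd _ _ (alternates (~~ b))); last first.
    by move=> t _ _; rewrite /consf /= eqxx.
  by rewrite IH negbK; case: b => /=; case: (alternates _ _) (alternates _ _) => [][].
rewrite (@eq_cobd _ _ (fun=> false)) ?cobd0 ?addbF; last first.
  by move=> t _ _; rewrite /consf /= (negbTE xb).
by case: x b xb => [][].
Qed.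

Lemma alternates_map_negb b s : alternates b (map negb s) = alternates (~~ b) s.
Proof. by elim: s b => //= x s IH b; rewrite IH; case: x b => [][]. Qed.

(* A label [l : nat] encodes the signed index: index [l./2], sign [odd l]. *)
Definition label_opp (l : nat) : nat := ~~ odd l + l./2.*2.

Definition compl_free (s : seq nat) :=
  forall x y, x \in s -> y \in s -> x./2 = y./2 -> odd x = odd y.

(* Sorting by labels makes [fan b] a cochain on unordered tuples. *)
Definition fan (b : bool) (s : seq nat) : bool :=
  alternates b (map odd (sort leq s)).

Lemma perm_fan b s s' : perm_eq s s' -> fan b s = fan b s'.
Proof.
by move/(perm_sortP leq_total leq_trans anti_leq); rewrite /fan => ->.
Qed.

Lemma cobd_fan b s : cobd (fan b) s = fan b s (+) fan (~~ b) s.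
Proof.
rewrite -cobd_alternates -cobd_map.
rewrite (@perm_cobd _ (fan b) s (sort leq s)); last 2 first.
- exact: perm_fan.
- by rewrite perm_sym perm_sort.
apply: eq_cobd => t /(subseq_sorted leq_trans) tS _.
rewrite /fan sorted_sort//; first exact: leq_trans.
by apply: tS; exact: sort_sorted leq_total _.
Qed.

Lemma odd_label_opp l : odd (label_opp l) = ~~ odd l.
Proof. by rewrite /label_opp oddD odd_double addbF oddb. Qed.

Lemma half_label_opp l : (label_opp l)./2 = l./2.
Proof. by rewrite /label_opp half_bit_double. Qed.

(** Taking opposites keeps the index, and without complementary pairs labels of equal index are
    equal; so the sorting order survives and only the signs flip. *)
Lemma fan_opp b s : compl_free s -> fan b (map label_opp s) = fan (~~ b) s.
Proof.
move=> sC; rewrite /fan -alternates_map_negb; congr alternates.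
suff -> : sort leq (map label_opp s) = map label_opp (sort leq s).
  by rewrite -!map_comp; apply: eq_map => x /=; rewrite odd_label_opp.
apply: (sorted_eq leq_trans anti_leq); first exact: sort_sorted leq_total _.
  rewrite sorted_map; apply: (sub_in_sorted (P := mem s)) (sort_sorted leq_total _).
    move=> x y xs ys xy; rewrite /= /relpre /=.
    have := sC _ _ xs ys; have := half_leq xy.
    rewrite leq_eqVlt => /predU1P[e /(_ e) o|h _].
      by rewrite /label_opp e o.
    rewrite -(odd_double_half (label_opp x)) -(odd_double_half (label_opp y)).
    rewrite !half_label_opp; apply: (@leq_trans x./2.+1.*2).
      by rewrite doubleS -addn2 addnC leq_add2l; case: odd.
    by apply: leq_trans (leq_addl _ _); rewrite leq_double.
  by apply/allP => x; rewrite mem_sort.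
by rewrite perm_sort perm_map// perm_sym perm_sort.
Qed.

(** Neighbours of opposite signs cannot share an index when no two labels are complementary. *)
Lemma alternates_sorted_half b s : compl_free s -> sorted leq s ->
  alternates b (map odd s) -> sorted ltn (map half s).
Proof.
case: s => //= x s; elim: s x b => //= y s IH x b sC /andP[xy ys].
case/and3P=> /eqP ox /eqP oy sA; apply/andP; split; last first.
  apply: (IH _ (~~ b)) => //; last by rewrite oy eqxx.
  by move=> z t zs ts; apply: sC; rewrite inE (zs, ts) orbT.
rewrite ltn_neqAle half_leq// andbT; apply/eqP => /sC.
by rewrite !inE !eqxx orbT ox oy => /(_ isT isT); case: (b).
Qed.

Lemma fan_size b s m : compl_free s -> (forall x, x \in s -> x./2 < m) ->
  fan b s -> size s <= m.
Proof.
move=> sC sm /alternates_sorted_half => /(_ _ _)/[!(sort_sorted leq_total)] sS.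
have /sS /(_ isT) {}sS : compl_free (sort leq s).
  by move=> x y; rewrite !mem_sort; exact: sC.
rewrite -(size_sort leq s) -(size_map half) -[leqRHS](size_iota 0).
apply: uniq_leq_size; first exact: (sorted_uniq ltn_trans ltnn).
by move=> _ /mapP[x + ->]; rewrite mem_sort mem_iota => /sm.
Qed.

Local Open Scope classical_set_scope.
Local Open Scope ring_scope.

(** * Barycentric subdivision *)

Section Subdivision.
Variables (R : realType) (V : normedModType R).
Implicit Types (f g : seq V -> bool) (s t : seq V) (K : set V) (d r : R).

Definition barycenter s : V := (size s)%:R^-1 *: \sum_(x <- s) x.

(* [subdiv f s] is the sum of [f] over the simplices of the barycentric
   subdivision of [s]; as the cone from the barycenter over the subdivided
   boundary, it is itself a coboundary. *)
Fixpoint subdiv_rec k f s : bool :=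
  if k is k'.+1 then cobd (subdiv_rec k' (consf (barycenter s) f)) s
  else f [::].

Definition subdiv f s := subdiv_rec (size s) f s.

Lemma subdivE f s : s != [::] ->
  subdiv f s = cobd (subdiv (consf (barycenter s) f)) s.
Proof. by case: s => // x s _; apply: eq_cobd => t _ [ts]; rewrite /subdiv ts. Qed.

Lemma seq_size_ind (P : seq V -> Prop) :
  P [::] ->
  (forall s, s != [::] -> (forall t, (size t).+1 = size s -> P t) -> P s) ->
  forall s, P s.
Proof.
move=> P0 PS s; have [k ks] : exists k, size s = k by exists (size s).
elim: k s ks => [[]//|k IH s sk]; apply: PS; first by case: s sk.
by move=> t; rewrite sk => -[/IH].
Qed.

Lemma subdivD f g s :
  subdiv (fun t => f t (+) g t) s = subdiv f s (+) subdiv g s.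
Proof.
elim/seq_size_ind: s f g => // s s0 IH f g; rewrite !subdivE// -cobdD.
by apply: eq_cobd => t _ ts; rewrite -IH.
Qed.

Lemma subdiv0 s : subdiv (fun=> false) s = false.
Proof.
elim/seq_size_ind: s => // s s0 IH; rewrite subdivE// -[RHS](cobd0 s).
by apply: eq_cobd => t _ ts; apply: IH.
Qed.

Lemma barycenterN s : barycenter (map -%R s) = - barycenter s.
Proof. by rewrite /barycenter size_map big_map sumrN scalerN. Qed.

Lemma subdiv_opp f s : subdiv (f \o map -%R) s = subdiv f (map -%R s).
Proof.
elim/seq_size_ind: s f => // s s0 IH f.
rewrite !subdivE//; last by case: s s0 {IH}.
rewrite -cobd_map barycenterN; apply: eq_cobd => t _ ts.
by rewrite -(IH t).
Qed.

(** Subdivision is a chain map: on the cone from the barycenter, [cobd f] splits off [f] on the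
    base; the rest is a coboundary by induction, and [cobd_cobd] kills it. *)
Lemma subdiv_cobd f s : subdiv (cobd f) s = cobd (subdiv f) s.
Proof.
elim/seq_size_ind: s f => // s s0 IH f; rewrite subdivE//.
transitivity (cobd (fun t => subdiv f t (+)
    cobd (subdiv (consf (barycenter s) f)) t) s).
  by apply: eq_cobd => t _ ts; rewrite -IH// -subdivD.
by rewrite cobdD cobd_cobd addbF.
Qed.

Definition fine_simplex K d s := [/\ {in s, forall x, K x} &
  {in s &, forall x y, `|x - y| <= d}].

Definition convex K := forall x y (a : R), 0 <= a <= 1 -> K x -> K y ->
  K (a *: x + (1 - a) *: y).

Lemma barycenter_convex K s : convex K -> s != [::] ->
  {in s, forall x, K x} -> K (barycenter s).
Proof.
move=> Kc; case: s => // x s _; elim/last_ind: s => [|s y IH] Ks.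
  by rewrite /barycenter /= big_seq1 invr1 scale1r; exact/Ks/mem_head.
rewrite /barycenter /= -rcons_cons big_rcons /=.
set k := (size s).+1; have k0 : k%:R != 0 :> R by rewrite pnatr_eq0.
have k1 : k.+1%:R != 0 :> R by rewrite pnatr_eq0.
rewrite size_rcons -/k.
have -> : k.+1%:R^-1 *: (\sum_(z <- x :: s) z + y) =
    (k%:R / k.+1%:R) *: barycenter (x :: s) + (1 - k%:R / k.+1%:R) *: y.
  rewrite /barycenter scalerDr scalerA; congr (_ *: _ + _ *: _).
    by rewrite mulrAC divff// mul1r.
  by apply: (mulfI k1); rewrite mulrBr mulrCA mulfV// !mulr1 -natr1 addrC addKr.
apply: Kc.
- rewrite divr_ge0//= ler_pdivrMr ?ltr0n// mul1r ler_nat; exact: leqnSn.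
- by apply: IH => z zs; apply: Ks; rewrite -rcons_cons mem_rcons inE zs orbT.
- by apply: Ks; rewrite -rcons_cons mem_rcons inE eqxx.
Qed.

(** [x - barycenter s] is the mean of the [n.+1] differences [x - y], of which the one with [y = x]
    vanishes. *)
Lemma dist_barycenter n d s x : size s = n.+1 -> x \in s ->
  {in s &, forall y z, `|y - z| <= d} ->
  `|x - barycenter s| <= (1 - n.+1%:R^-1) * d.
Proof.
move=> sn xs sd; have n0 : n.+1%:R != 0 :> R by rewrite pnatr_eq0.
have -> : x - barycenter s = n.+1%:R^-1 *: \sum_(y <- s) (x - y).
  rewrite big_split/= sumrN big_const_seq count_predT sn iter_addr addr0.
  by rewrite scalerBr -[x *+ _]scaler_nat scalerA mulVf// scale1r /barycenter sn.
rewrite normrZ ger0_norm ?invr_ge0//.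
have -> : 1 - n.+1%:R^-1 = n.+1%:R^-1 * n%:R :> R.
  by apply: (mulfI n0); rewrite mulrBr mulrA mulfV// mulr1 mul1r -natr1 addrK.
rewrite -mulrA ler_wpM2l ?invr_ge0// (perm_big _ (perm_to_rem xs)) big_cons.
rewrite /= subrr add0r (le_trans (ler_norm_sum _ _ _))//.
have -> : n%:R * d = \sum_(y <- rem x s) d.
  by rewrite big_const_seq count_predT size_rem// sn iter_addr addr0 mulr_natl.
rewrite big_seq [leRHS]big_seq ler_sum// => y /mem_rem ys; exact: sd.
Qed.

(** Locality: [subdiv f s] only sees [f] on simplices of the subdivision, so a cochain may be
    replaced by one agreeing with it at small scale. *)
Lemma eq_subdiv_fine n K d f g s : convex K -> 0 <= d -> (size s <= n.+1)%N ->
  fine_simplex K d s ->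
  (forall t, size t = size s -> fine_simplex K ((1 - n.+1%:R^-1) * d) t -> f t = g t) ->
  subdiv f s = subdiv g s.
Proof.
move=> + d0; elim/seq_size_ind: s K f g => [|s s0 IH] K f g Kc sn [sK sd] fg.
  by apply: fg => //; split.
rewrite !subdivE//; apply: eq_cobd => t ts tz.
have tSs x : x \in t -> x \in s by exact: mem_subseq.
set b := barycenter s; set r := (1 - n.+1%:R^-1) * d in fg *.
have bs x : x \in s -> `|x - b| <= r.
  move=> xs; apply: le_trans (dist_barycenter _ xs sd) _; first by rewrite -tz.
  by rewrite ler_wpM2r// lerB// lef_pV2 ?posrE ?ltr0n// ler_nat tz.
have r0 : 0 <= r.
  by rewrite mulr_ge0// subr_ge0 invf_le1 ?ltr0n// ler1n.
(* The smaller convex set keeps the new vertices within [r] of [b]. *)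
apply: (IH _ _ (K `&` [set x | `|x - b| <= r])) => //.
- move=> x y a a01 [Kx xb] [Ky yb]; split; first exact: Kc.
  rewrite /=; have -> : a *: x + (1 - a) *: y - b = a *: (x - b) + (1 - a) *: (y - b).
    by rewrite !scalerBr addrACA -opprD -scalerDl subrKC scale1r.
  have /andP[a0 a1] := a01; rewrite -subr_ge0 in a1.
  rewrite (le_trans (ler_normD _ _))// !normrZ !ger0_norm//.
  have -> : r = a * r + (1 - a) * r by rewrite -mulrDl subrKC mul1r.
  by rewrite lerD// ler_wpM2l.
- by rewrite ltnW// tz.
- split => [x /tSs xs|x y /tSs xs /tSs ys]; last exact: sd.
  by split; [exact: sK|exact: bs].
move=> t' t't [Kt' dt']; apply: fg; first by rewrite /= t't.
split=> [x|x y]; rewrite !inE.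
  by move=> /predU1P[->|/Kt'[]//]; exact: barycenter_convex.
move=> /predU1P[->|xt'] /predU1P[->|yt'].
- by rewrite subrr normr0.
- by rewrite distrC; have [] := Kt' _ yt'.
- by have [] := Kt' _ xt'.
- exact: dt'.
Qed.

Lemma eq_iter_subdiv_fine n N K d f g s : convex K -> 0 <= d ->
  (size s <= n.+1)%N -> fine_simplex K d s ->
  (forall t, size t = size s -> fine_simplex K ((1 - n.+1%:R^-1) ^+ N * d) t ->
    f t = g t) ->
  iter N subdiv f s = iter N subdiv g s.
Proof.
move=> Kc; elim: N d s => [|N IH] d s d0 sn sK fg.
  by apply: fg => //; rewrite mul1r.
apply: (eq_subdiv_fine Kc d0 sn sK) => t ts tK.
apply: (IH _ _ _ _ tK); rewrite ?ts//.
  by rewrite mulr_ge0// subr_ge0 invf_le1 ?ltr0n// ler1n.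
by move=> t' t't; rewrite mulrA -exprSr; exact: fg.
Qed.

Lemma iter_subdivD N f g :
  iter N subdiv (fun t => f t (+) g t) =
  (fun s => iter N subdiv f s (+) iter N subdiv g s).
Proof. by elim: N => //= N ->; apply/funext => s; rewrite subdivD. Qed.

Lemma iter_subdiv0 N : iter N subdiv (fun=> false) = (fun=> false).
Proof. by elim: N => //= N ->; apply/funext => s; rewrite subdiv0. Qed.

Lemma iter_subdiv_opp N f :
  iter N subdiv (f \o map -%R) = iter N subdiv f \o map -%R.
Proof. by elim: N => //= N ->; apply/funext => s; rewrite subdiv_opp. Qed.

Lemma iter_subdiv_cobd N f :
  iter N subdiv (cobd f) = cobd (iter N subdiv f).
Proof. by elim: N => //= N ->; apply/funext => s; rewrite subdiv_cobd. Qed.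

Lemma iter_subdiv_nil N f : iter N subdiv f [::] = f [::].
Proof. by elim: N. Qed.

End Subdivision.

(** * The boundary cycle of the cross-polytope *)

Section CrossPolytope.
Variables (V : zmodType) (I : eqType) (e : I -> V).
Implicit Types (f g : seq V -> bool) (l : seq I).

(* The sum of [f] over the facets [+- e i] of the cross-polytope with axes [l]. *)
Fixpoint cross f l : bool :=
  if l is i :: l' then
    cross (consf (e i) f) l' (+) cross (consf (- e i) f) l'
  else f [::].

Definition signing (b : I -> bool) l := [seq if b i then - e i else e i | i <- l].

Lemma signing_cons b c i l : i \notin l ->
  signing (fun j => if j == i then c else b j) (i :: l) =
  (if c then - e i else e i) :: signing b l.
Proof.
move=> il; rewrite /signing /= eqxx; congr (_ :: _); apply/eq_in_map => j jl.
by case: eqP => // ji; rewrite ji (negbTE il) in jl *.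
Qed.

Lemma eq_cross f g l : uniq l -> (forall b, f (signing b l) = g (signing b l)) ->
  cross f l = cross g l.
Proof.
elim: l f g => [|i l IH] f g; first by move=> _ /(_ xpred0).
rewrite cons_uniq => /andP[il ul] fg /=; congr (_ (+) _); apply: IH => // b.
  by have := fg (fun j => if j == i then false else b j);
    rewrite signing_cons.
by have := fg (fun j => if j == i then true else b j);
  rewrite signing_cons.
Qed.

Lemma crossD f g l :
  cross (fun t => f t (+) g t) l = cross f l (+) cross g l.
Proof.
elim: l f g => //= i l IH f g.
by rewrite (IH (consf _ f) (consf _ g)) (IH (consf (- _) f) (consf _ g)) addbACA.
Qed.

Lemma cross_opp f l : cross (f \o map -%R) l = cross f l.
Proof.
elim: l f => //= i l IH f; rewrite addbC -(IH (consf (e i) f)).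
rewrite -(IH (consf (- e i) f)); congr (cross _ l (+) cross _ l).
by apply/funext => t; rewrite /consf /= opprK.
Qed.

(** The boundary of the cross-polytope is a cycle: the faces opposite to [e i] and to [- e i]
    coincide and cancel. *)
Lemma cross_cobd f l : cross (cobd f) l = false.
Proof.
elim: l f => //= i l IH f.
by rewrite (crossD f (cobd (consf (e i) f))) (crossD f (cobd (consf _ f)))
  !IH !addbF addbb.
Qed.

End CrossPolytope.

(** * The Borsuk-Ulam theorem *)

Section L1Sphere.
Variables (R : realType) (n : nat).
Implicit Types x y : 'rV[R]_n.

Definition l1norm x := \sum_(i < n) `|x 0 i|.

(** This is the boundary of the cross-polytope itself, so subdivided facets stay on the sphere. *)
Definition l1sphere : set 'rV[R]_n := [set x | l1norm x = 1].

Definition evec (i : 'I_n) : 'rV[R]_n := delta_mx 0 i.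

Lemma l1normN x : l1norm (- x) = l1norm x.
Proof. by apply: eq_bigr => i _; rewrite mxE normrN. Qed.

Lemma norm_le_l1norm x : `|x| <= l1norm x.
Proof.
rewrite [leLHS]/Num.Def.normr/= mx_normrE; apply: bigmax_le => [|[i j] _ /=].
  by apply: sumr_ge0.
by rewrite (ord1 i) /l1norm (bigD1 j)//= lerDl sumr_ge0.
Qed.

Lemma l1sphere_neq0 x : l1sphere x -> x != 0.
Proof.
move=> x1; apply/eqP => x0; move: x1; rewrite /l1sphere /= /l1norm x0.
under eq_bigr do rewrite mxE normr0.
by rewrite big1// => /eqP; rewrite eq_sym oner_eq0.
Qed.

Lemma continuous_l1norm : continuous l1norm.
Proof.
apply: (@continuous_big _ _ _ _ _ (@add_continuous R)) => i _ x.
have c : {for x, continuous (fun y : 'rV[R]_n => y 0 i)}.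
  exact: coord_continuous.
exact: (continuous_comp c (@norm_continuous R R^o _)).
Qed.

Lemma compact_l1sphere : compact l1sphere.
Proof.
apply: bounded_closed_compact.
  exists 1; split=> // M M1 x x1; apply: le_trans (ltW M1).
  by rewrite -x1 norm_le_l1norm.
apply: (preimage_closed (f := l1norm)) (@closed_eq R 1) => x _.
exact: continuous_l1norm.
Qed.

(* The conditions [`|x 0 i| = +- x 0 i] say that [x] lies in the orthant of signs
   [b]. *)
Definition facet (b : 'I_n -> bool) : set 'rV[R]_n :=
  [set x | l1sphere x /\ forall i, `|x 0 i| = (-1) ^+ b i * x 0 i].

Lemma convex_facet b : convex (facet b).
Proof.
move=> x y a /andP[a0 a1] [x1 xb] [y1 yb]; rewrite -subr_ge0 in a1.
have sE i : (-1) ^+ b i * (a *: x + (1 - a) *: y) 0 i =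
    a * `|x 0 i| + (1 - a) * `|y 0 i|.
  by rewrite !mxE mulrDr xb yb ![_ ^+ _ * _]mulrCA.
have xyE i : `|(a *: x + (1 - a) *: y) 0 i| = a * `|x 0 i| + (1 - a) * `|y 0 i|.
  rewrite -(normrMsign (b i)) sE ger0_norm//.
  by rewrite addr_ge0// mulr_ge0.
split; last by move=> i; rewrite xyE -sE.
rewrite /l1sphere /= /l1norm; under eq_bigr do rewrite xyE.
rewrite big_split/= -!mulr_sumr (_ : \sum_i `|x 0 i| = 1)//.
by rewrite (_ : \sum_i `|y 0 i| = 1)// !mulr1 subrKC.
Qed.

Lemma fine_signing b l : fine_simplex (facet b) 2 (signing evec b l).
Proof.
have bF i : facet b (if b i then - evec i else evec i).
  have -> : (if b i then - evec i else evec i) = (-1) ^+ b i *: evec i.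
    by case: (b i); rewrite ?expr1 ?expr0 ?scaleN1r ?scale1r.
  split.
    rewrite /l1sphere /= /l1norm (bigD1 i)//= big1 => [|j ji].
      by rewrite !mxE !eqxx mulr1 normrX normrN1 expr1n addr0.
    by rewrite !mxE (negbTE ji) andbF mulr0 normr0.
  move=> j; rewrite !mxE; have [->|_] := eqVneq j i; last by rewrite andbF !mulr0 normr0.
  by rewrite eqxx !mulr1 normrX normrN1 expr1n -expr2 sqrr_sign.
have F x : x \in signing evec b l -> facet b x by move=> /mapP[i _ ->].
split=> // x y /F[x1 _] /F[y1 _]; rewrite (le_trans (ler_normB _ _))//.
have -> : 2%R = l1norm x + l1norm y :> R by rewrite x1 y1.
by rewrite lerD// norm_le_l1norm.
Qed.

End L1Sphere.

(** * Tucker's lemma *)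

Section Tucker.
Variables (R : realType) (n : nat) (lab : 'rV[R]_n -> nat) (m : nat) (d : R).
Hypothesis d0 : 0 < d.
Hypothesis lab_opp : forall x, l1sphere x -> lab (- x) = label_opp (lab x).
Hypothesis lab_lt : forall x, l1sphere x -> ((lab x)./2 < m)%N.
Hypothesis lab_compl : forall x y, l1sphere x -> l1sphere y -> `|x - y| <= d ->
  (lab x)./2 = (lab y)./2 -> odd (lab x) = odd (lab y).

Let fanl b (s : seq 'rV[R]_n) := fan b (map lab s).

Lemma fine_compl_free s : fine_simplex (@l1sphere R n) d s ->
  compl_free (map lab s).
Proof.
move=> [s1 sd] _ _ /mapP[x xs ->] /mapP[y ys ->].
by apply: lab_compl; [exact: s1|exact: s1|exact: sd].
Qed.

Lemma mesh_le : exists N, (1 - n.+1%:R^-1) ^+ N * 2 <= d.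
Proof.
have : (fun N => (1 - n.+1%:R^-1 : R) ^+ N) @ \oo --> (0 : R).
  by apply: cvg_expr; rewrite ger0_norm ?subr_ge0 ?invf_le1 ?ltr0n ?ler1n//.
move=> /cvgrPdist_lt /(_ (d / 2)) []; first by rewrite divr_gt0.
move=> N _ /(_ N (leqnn N)); rewrite sub0r normrN => Nd; exists N.
by rewrite -ler_pdivlMr// (le_trans (ler_norm _))// ltW.
Qed.

Lemma eq_iter_subdiv_signing N (f g : seq 'rV[R]_n -> bool) b l :
  (1 - n.+1%:R^-1) ^+ N * 2 <= d -> uniq l ->
  (forall t, size t = size l -> fine_simplex (@l1sphere R n) d t -> f t = g t) ->
  iter N (@subdiv R _) f (signing (@evec R n) b l) =
  iter N (@subdiv R _) g (signing (@evec R n) b l).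
Proof.
move=> Nd ul fg; set s := signing _ b l; have ls : size s = size l by rewrite size_map.
apply: (@eq_iter_subdiv_fine R _ n N (facet b) 2) => //.
- exact: convex_facet.
- by rewrite ls ltnW// ltnS -[leqRHS]card_ord -(card_uniqP ul) max_card.
- exact: fine_signing.
move=> t; rewrite ls => ts [t1 td]; apply: fg => //; split.
  by move=> x /t1[].
by move=> x y xt yt; exact: le_trans (td _ _ xt yt) Nd.
Qed.

Lemma cross_fan N l : (1 - n.+1%:R^-1) ^+ N * 2 <= d -> uniq l ->
  cross (@evec R n) (iter N (@subdiv R _) (fanl true)) l.
Proof.
move=> Nd; elim: l => [|i l IH]; first by rewrite /= iter_subdiv_nil.
move=> /[dup] ul; rewrite cons_uniq => /andP[il ul'].
set S := iter N (@subdiv R _); set e := @evec R n.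
suff -> : cross e (S (fanl true)) (i :: l) = cross e (S (fanl true)) l by exact: IH.
(* The facets through [- e i] are antipodal to those through [e i]; [cross_opp] moves their sum to
   the latter. *)
have -> : cross e (S (fanl true)) (i :: l) =
    cross e (consf (e i) (S (fanl true))) l (+)
    cross e (consf (e i) (S (fanl true \o map -%R))) l.
  rewrite [LHS]/= -[in X in _ (+) X]cross_opp /S iter_subdiv_opp.
  by congr (_ (+) cross _ _ l).
(* Fine simplices have no complementary labels, so on them the antipode turns [fan true] into
   [fan false]. *)
have -> : cross e (consf (e i) (S (fanl true \o map -%R))) l =
    cross e (consf (e i) (S (fanl false))) l.
  apply: eq_cross => // b; have := @eq_iter_subdiv_signing N (fanl true \o map -%R)
    (fanl false) (fun j => if j == i then false else b j) (i :: l) Nd ul.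
  rewrite signing_cons//; apply => t _ tS; rewrite /fanl /= -map_comp.
  rewrite -[RHS](fan_opp true); last exact: fine_compl_free.
  rewrite -map_comp; congr fan; apply/eq_in_map => x xt /=.
  by apply: lab_opp; case: tS => + _; exact.
rewrite -crossD.
(* Both halves together give the coboundary of [S (fanl true)]; on a cone from [e i] it is
   [S (fanl true)] on the base plus a coboundary, which sums to zero over a cycle. *)
have -> : (fun t => consf (e i) (S (fanl true)) t (+) consf (e i) (S (fanl false)) t)
    = consf (e i) (cobd (S (fanl true))).
  rewrite -iter_subdiv_cobd; apply/funext => t; rewrite /consf -/(S _).
  have -> : cobd (fanl true) = (fun t => fanl true t (+) fanl false t).
    by apply/funext => t'; rewrite /fanl -cobd_fan -cobd_map.
  by rewrite /S iter_subdivD.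
rewrite (crossD _ (S (fanl true)) (cobd (consf (e i) (S (fanl true))))).
by rewrite cross_cobd addbF.
Qed.

(** If [m < n], the [n] vertices of a fine simplex cannot have distinct indices, so [fan true]
    vanishes at small mesh, against its odd sum in [cross_fan]. *)
Lemma tucker : (n <= m)%N.
Proof.
have [N Nd] := mesh_le; rewrite leqNgt; apply/negP => mn.
have /negP[] : ~~ cross (@evec R n) (iter N (@subdiv R _) (fun=> false)) (enum 'I_n).
  rewrite iter_subdiv0; elim: (enum _) => //= i l IH.
  by rewrite /consf (negbTE IH).
rewrite -(@eq_cross _ _ _ (iter N (@subdiv R _) (fanl true))) ?enum_uniq//.
  exact: cross_fan Nd (enum_uniq _).
move=> b; apply: eq_iter_subdiv_signing; rewrite ?enum_uniq// => t tn tS.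
have tm x : x \in map lab t -> (x./2 < m)%N.
  by move=> /mapP[y yt ->]; apply: lab_lt; case: tS => + _; exact.
apply/negbTE/negP => /(fan_size (fine_compl_free tS) tm).
by rewrite size_map tn size_enum_ord leqNgt mn.
Qed.
End Tucker.

Lemma borsuk_ulam (R : realType) (n : nat) (T : finType)
    (h : T -> 'rV[R]_n -> R) :
  (#|T| < n)%N -> (forall t, continuous (h t)) ->
  (forall t x, h t (- x) = - h t x) ->
  exists2 x, l1sphere x & forall t, h t x = 0.
Proof.
move=> Tn hc hN; apply: contrapT => no0.
pose steady (d : R) x t := forall y, `|x - y| <= d -> 0 < h t x * h t y.
(* [d] acts as a Lebesgue number: by compactness one radius serves all points of the sphere. *)
have [d d0 dP] : exists2 d : R, 0 < d &
    forall x, l1sphere x -> exists t, steady d x t.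
  have : \forall d \near 0^'+, @l1sphere R n `<=` [set x | exists t, steady d x t].
    have /compact_near_coveringP := @compact_l1sphere R n; apply => x x1.
    have [t htx] : exists t, h t x != 0.
      apply: contrapT => h0; apply: no0; exists x => // t.
      by apply/eqP/negPn/negP => ht; apply: h0; exists t.
    have : \forall y \near x, 0 < h t x * h t y.
      have c : {for x, continuous (fun y => h t x * h t y)}.
        apply: (@continuousM R _ (cst (h t x)) (h t)); last exact: hc.
        exact: cst_continuous.
      by move/cvgr_gt : c; apply; rewrite -expr2 exprn_even_gt0.
    move=> /nbhs_ballP[e /= e0 xe].
    (* Half of the radius is spent on the way from [x] to [x'], half on the way from [x'] to [y]. *)
    exists (ball x (e / 2), [set d : R | d < e / 2]) => /=.
      split; first by apply: nbhsx_ballx; rewrite divr_gt0.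
      by apply: nbhs_right_lt; rewrite divr_gt0.
    move=> [x' d] /= [xx' de]; exists t => y x'y.
    have hx : 0 < h t x * h t x'.
      by apply: xe; apply: le_ball xx'; rewrite ler_pdivrMr// ler_peMr ?ltW// ltr1n.
    have hy : 0 < h t x * h t y.
      apply: xe; rewrite -ball_normE /= in xx' *.
      rewrite -(subrKA x') (le_lt_trans (ler_normD _ _))// [e]splitr ltrD//.
      exact: le_lt_trans de.
    have /(pmulr_rgt0 _) <- : 0 < h t x ^+ 2 by rewrite exprn_even_gt0.
    by rewrite expr2 mulrACA mulr_gt0.
  move=> H; near (0 : R)^'+ => d; exists d; first by [].
  by near: d.
have steadyN x t : steady d (- x) t <-> steady d x t.
  have H x' : steady d x' t -> steady d (- x') t.
    move=> xt y xy; rewrite hN mulNr -mulrN -hN; apply: xt.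
    by rewrite opprK -normrN opprD.
  by split=> [/H|/H//]; rewrite opprK.
(* A point is labelled by a coordinate whose sign is constant on the [d]-ball
   around it, together with that sign. *)
pose lab x : nat := if [pick t | `[<steady d x t>]] is Some t
  then ((0 < h t x)%R + (enum_rank t).*2)%N else 0%N.
have labE x : l1sphere x -> exists t, [/\ steady d x t,
    odd (lab x) = (0 < h t x), (lab x)./2 = enum_rank t &
    lab (- x) = label_opp (lab x)].
  (* [pick] faces the same predicate at [x] and at [- x], so both points get the same index. *)
  move=> x1; rewrite /lab (@eq_pick _ (fun t => `[<steady d (- x) t>])
    (fun t => `[<steady d x t>])); last first.
    by move=> t; apply/asboolP/asboolP => /steadyN.
  case: pickP => [t /asboolP xt|no]; last first.
    by have [t xt] := dP _ x1; have := no t; rewrite asboolT.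
  exists t; rewrite half_bit_double oddD odd_double addbF oddb; split=> //.
  rewrite /label_opp half_bit_double oddD odd_double addbF oddb hN oppr_gt0.
  have : h t x != 0.
    have := xt x; rewrite subrr normr0 => /(_ (ltW d0)).
    by apply: contraTneq => ->; rewrite mul0r ltxx.
  by case: ltgtP.
suff : (n <= #|T|)%N by rewrite leqNgt Tn.
apply: (@tucker R n lab #|T| d d0) => [x x1|x x1|x y x1 y1 xy].
- by have [t []] := labE x x1.
- by have [t [_ _ -> _]] := labE x x1.
have [t [xt -> -> _]] := labE _ x1; have [u [yu -> -> _]] := labE _ y1.
move=> /ord_inj/enum_rank_inj tu; rewrite -tu.
have := xt _ xy; case: (ltgtP (h t x) 0) => hx.
- by rewrite nmulr_rgt0// => /ltW; rewrite leNgt => /negbTE ->.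
- by rewrite pmulr_rgt0// => ->.
- by rewrite hx mul0r ltxx.
Unshelve. all: by end_near. Qed.

(** * Separation of the families *)

Section Separation.
Variables (R : realType) (n : nat) (K : finType) (c : K -> 'I_n.+1).
Variables (lo hi : K -> 'rV[R]_n -> R).
Hypothesis lo_cont : forall k, continuous (lo k).
Hypothesis hi_cont : forall k, continuous (hi k).
Hypothesis loN : forall k u, lo k (- u) = - hi k u.
Hypothesis lo_hi : forall k l u, c k = c l -> lo k u <= hi l u.
Hypothesis gap : forall u, l1sphere u -> exists k l, hi l u < lo k u.

Definition excess i u : R :=
  \big[Num.max/0]_(k | c k == i) \big[Num.max/0]_l (lo k u - hi l u).

Definition balance i u : R := excess i u - excess i (- u).

Lemma hiN k u : hi k (- u) = - lo k u.
Proof. by rewrite -[X in lo k X]opprK loN opprK. Qed.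

Lemma continuous_excess i : continuous (excess i).
Proof.
have maxc : continuous (fun x : R * R => Num.max x.1 x.2).
  by move=> x; apply: (@continuous_max R _ fst snd); [exact: cvg_fst|exact: cvg_snd].
apply: (@continuous_big _ _ _ _ _ maxc) => k _.
apply: (@continuous_big _ _ _ _ _ maxc) => l _ u.
by apply: (@continuousB R _ _ (lo k) (hi l)); [exact: lo_cont|exact: hi_cont].
Qed.

Lemma continuous_balance i : continuous (balance i).
Proof.
move=> u; apply: (@continuousB R _ _ (excess i) (fun u => excess i (- u))).
  exact: continuous_excess.
apply: continuous_comp; first exact: opp_continuous.
exact: continuous_excess.
Qed.

Lemma balanceN i u : balance i (- u) = - balance i u.
Proof. by rewrite /balance opprK opprB. Qed.

(** [lo k u - hi l u] bounds the excess of every family. A family whose balance equals it must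
    attain it, since the balance is at most the excess. *)
Lemma balance_extreme u k l :
  (forall k', lo k' u <= lo k u) -> (forall l', hi l u <= hi l' u) ->
  hi l u < lo k u ->
  balance (c k) u = lo k u - hi l u /\
  (forall i, balance i u = lo k u - hi l u ->
     exists2 k', c k' = i & lo k u <= lo k' u).
Proof.
move=> kmax lmin kl; have kl0 : 0 < lo k u - hi l u by rewrite subr_gt0.
have excess_ge0 i v : 0 <= excess i v by exact: bigmax_ge_id.
have excess_le i : excess i u <= lo k u - hi l u.
  apply: bigmax_le => [|k' _]; first exact: ltW.
  by apply: bigmax_le => [|l' _]; [exact: ltW|exact: lerB].
split.
  (* The excess of [c k] at [- u] is zero: every [lo l' u] is at most [lo k u], hence at most
     [hi k' u] for [k'] in the family of [k]. *)
  have -> : balance (c k) u = excess (c k) u.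
    rewrite /balance [X in _ - X](_ : _ = 0) ?subr0//; apply/le_anti.
    rewrite excess_ge0 andbT; apply: bigmax_le => // k' /eqP ck.
    apply: bigmax_le => // l' _; rewrite loN hiN opprK addrC subr_le0.
    exact: le_trans (kmax l') (lo_hi u (esym ck)).
  apply/le_anti; rewrite excess_le/=.
  apply/bigmax_geP; right; exists k; first exact: eqxx.
  by apply/bigmax_geP; right; exists l.
move=> i bi; apply: contrapT => no.
have : excess i u < lo k u - hi l u.
  apply: bigmax_lt => // k' /eqP ck'; apply: bigmax_lt => // l' _.
  rewrite ltr_leB//; rewrite ltNge; apply/negP => kk'; apply: no.
  by exists k'.
by rewrite -bi ltNge gerBl excess_ge0.
Qed.

Lemma separation (I : {set 'I_n.+1}) :
  I != finset.set0 -> (~: I)%SET != finset.set0 ->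
  exists u a, [/\ l1sphere u,
    (forall i, i \in I -> exists2 k, c k = i & a < lo k u) &
    (forall i, i \notin I -> exists2 k, c k = i & hi k u < a)].
Proof.
move=> /finset.set0Pn[i1 i1I] /finset.set0Pn[i2]; rewrite inE => i2I.
(* One representative is fixed in each part; comparing the other [n - 1] indices with them gives the
   equations for Borsuk-Ulam. *)
pose r i := if i \in I then i1 else i2.
pose T := {i | i \notin [:: i1; i2]}.
have [|||u u1 ur] := @borsuk_ulam R n T
  (fun t u => balance (val t) u - balance (r (val t)) u).
- have i12 : i1 != i2 by apply: contraNneq i2I => <-.
  have := cardC (mem [:: i1; i2]); rewrite card_ord => /eq_leq.
  rewrite (card_uniqP (_ : uniq [:: i1; i2])) /= ?inE ?i12// add2n ltnS.
  by apply: leq_trans; rewrite ltnS card_sig; apply: eq_leq; apply: eq_card.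
- move=> t u; apply: (@continuousB R _ _ (balance (val t)) (balance (r (val t))));
  exact: continuous_balance.
- by move=> t u; rewrite /= !balanceN [RHS]opprD.
have {}ur i : balance i u = balance (r i) u.
  have [|iN] := boolP (i \in [:: i1; i2]).
    by rewrite !inE => /orP[]/eqP ->; rewrite /r ?i1I ?(negbTE i2I).
  by apply/eqP; rewrite -subr_eq0; apply/eqP; exact: (ur (Sub i iN)).
(* At [- v] the roles of [lo] and [hi], and so of [k] and [l], are exchanged. *)
have extreme_opp v k l : (forall k', lo k' v <= lo k v) ->
    (forall l', hi l v <= hi l' v) -> hi l v < lo k v ->
    balance (c l) v = - (lo k v - hi l v) /\
    (forall i, balance i v = - (lo k v - hi l v) ->
       exists2 l', c l' = i & hi l' v <= hi l v).
  move=> kmax lmin kl; have [||| lE lP] := @balance_extreme (- v) l k.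
  - by move=> k'; rewrite !loN lerN2.
  - by move=> l'; rewrite !hiN lerN2.
  - by rewrite loN hiN ltrN2.
  rewrite loN hiN opprK addrC in lE lP; split; first by rewrite -lE balanceN opprK.
  move=> i ib; have [|l' cl'] := lP i; first by rewrite balanceN ib opprK.
  by rewrite !loN lerN2; exists l'.
have key v k l : l1sphere v -> (forall i, balance i v = balance (r i) v) ->
    (forall k', lo k' v <= lo k v) -> (forall l', hi l v <= hi l' v) ->
    hi l v < lo k v -> c k \in I -> c l \notin I ->
    exists u a, [/\ l1sphere u,
      (forall i, i \in I -> exists2 k, c k = i & a < lo k u) &
      (forall i, i \notin I -> exists2 k, c k = i & hi k u < a)].
  move=> v1 vr kmax lmin kl kI lI.
  have [kE kP] := balance_extreme kmax lmin kl.
  have [lE lP] := extreme_opp _ _ _ kmax lmin kl.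
  exists v, ((hi l v + lo k v) / 2); split=> // i iI.
    have [|k' ck' kk'] := kP i; last first.
      by exists k' => //; apply: lt_le_trans kk'; exact: (midf_lt kl).2.
    by rewrite -kE vr [RHS]vr /r iI kI.
  have [|l' cl' ll'] := lP i; last first.
    by exists l' => //; apply: le_lt_trans ll' _; exact: (midf_lt kl).1.
  by rewrite -lE vr [RHS]vr /r (negbTE iI) (negbTE lI).
have [k0 [l0 kl0]] := gap u1.
have [k _ kmax] := @Order.TotalTheory.arg_maxP _ _ _ k0 xpredT (lo^~ u) isT.
have [l _ lmin] := @Order.TotalTheory.arg_minP _ _ _ l0 xpredT (hi^~ u) isT.
have kl : hi l u < lo k u.
  by apply: le_lt_trans (lmin l0 isT) _; apply: lt_le_trans kl0 (kmax k0 isT).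
have {}kmax k' := kmax k' isT; have {}lmin l' := lmin l' isT.
have kE := (balance_extreme kmax lmin kl).1.
have lE := (extreme_opp _ _ _ kmax lmin kl).1.
(* The balances at [c k] and [c l] have opposite signs, whereas the balance is constant on each
   part. *)
have neq : (c k \in I) != (c l \in I).
  apply/eqP => ckl; have : balance (c k) u = balance (c l) u.
    by rewrite ur [RHS]ur /r ckl.
  apply/eqP; rewrite kE lE gt_eqF// (@lt_trans _ _ 0)// ?oppr_lt0 subr_gt0//.
have [kI|kI] := boolP (c k \in I).
  apply: (key u k l) => //.
  by move: neq; rewrite kI; case: (c l \in I).
apply: (key (- u) l k) => //.
- by rewrite /l1sphere /= l1normN.
- by move=> i; rewrite !balanceN ur.
- by move=> k'; rewrite !loN lerN2.
- by move=> l'; rewrite !hiN lerN2; exact: kmax.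
- by rewrite loN hiN ltrN2.
- by move: neq; rewrite (negbTE kI); case: (c l \in I).
Qed.
End Separation.

(** * Support functions of compact sets *)

Section Support.
Variables (R : realType) (n : nat).
Implicit Types (u v x y : 'rV[R]_n) (C D : set 'rV[R]_n).

Lemma dotNl u x : dot (- u) x = - dot u x.
Proof. by rewrite /dot -sumrN; apply: eq_bigr => i _; rewrite mxE mulNr. Qed.

Lemma dotBl u v x : dot (u - v) x = dot u x - dot v x.
Proof. by rewrite /dot -sumrB; apply: eq_bigr => i _; rewrite !mxE mulrBl. Qed.

Lemma dotDr u x y : dot u (x + y) = dot u x + dot u y.
Proof. by rewrite /dot -big_split; apply: eq_bigr => i _; rewrite mxE mulrDr. Qed.

Lemma dotZr u a x : dot u (a *: x) = a * dot u x.
Proof. by rewrite /dot mulr_sumr; apply: eq_bigr => i _; rewrite mxE mulrCA. Qed.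

Lemma dot_gt0 u : u != 0 -> 0 < dot u u.
Proof.
move=> u0; rewrite lt_def sumr_ge0 ?andbT; last by move=> i _; exact: sqr_ge0.
apply: contra_neq u0 => /eqP; rewrite psumr_eq0; last by move=> i _; exact: sqr_ge0.
move=> /allP ui; apply/rowP => i; rewrite mxE.
by have := ui i (mem_index_enum _); rewrite /= mulf_eq0 orbb => /eqP.
Qed.

Lemma dot_line_proj u x : u != 0 -> dot u (line_proj u x) = dot u x.
Proof. by move=> u0; rewrite /line_proj dotZr divfK// gt_eqF// dot_gt0. Qed.

Lemma norm_dot u x : `|dot u x| <= `|u| * l1norm x.
Proof.
rewrite (le_trans (ler_norm_sum _ _ _))// mulr_sumr ler_sum// => i _.
rewrite normrM ler_wpM2r// [leRHS]/Num.Def.normr/= mx_normrE.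
by apply/bigmax_geP; right; exists (0, i).
Qed.

Lemma continuous_dot u : continuous (dot u).
Proof.
apply: (@continuous_big _ _ _ _ _ (@add_continuous R)) => i _ x.
apply: (@continuousM R _ (cst (u 0 i)) (fun y : 'rV[R]_n => y 0 i)).
  exact: cst_continuous.
exact: coord_continuous.
Qed.

Definition support_max C u : R := sup (dot u @` C).
Definition support_min C u : R := - support_max C (- u).

Lemma support_maxP C u : compact C -> C !=set0 ->
  (exists2 x, C x & dot u x = support_max C u) /\
  (forall x, C x -> dot u x <= support_max C u).
Proof.
move=> cC C0; have [|x] := @compact_EVT_max _ R (dot u) _ C0 cC.
  by apply: continuous_subspaceT; exact: continuous_dot.
rewrite in_setE => Cx xmax.
have ub : ubound (dot u @` C) (dot u x).
  by move=> _ [y Cy <-]; apply: xmax; rewrite in_setE.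
have <- : dot u x = support_max C u.
  apply/le_anti; rewrite ge_sup ?andbT//; last by exists (dot u x), x.
  by apply: ub_le_sup; [exists (dot u x)|exists x].
by split=> [|y Cy]; [exists x|apply: xmax; rewrite in_setE].
Qed.

Lemma support_minP C u : compact C -> C !=set0 ->
  (exists2 x, C x & dot u x = support_min C u) /\
  (forall x, C x -> support_min C u <= dot u x).
Proof.
move=> cC C0; have [[x Cx xE] xmax] := support_maxP (- u) cC C0.
split=> [|y Cy]; first by exists x; rewrite // /support_min -xE dotNl opprK.
by rewrite /support_min lerNl -dotNl; exact: xmax.
Qed.

(** A supremum of linear functions over [C] is Lipschitz, with constant the maximum of the [l1] norm
    on [C]. *)
Lemma continuous_support_max C : compact C -> C !=set0 ->
  continuous (support_max C).
Proof.
move=> cC C0; have [|z _ zM] := @compact_EVT_max _ R (@l1norm R n) _ C0 cC.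
  by apply: continuous_subspaceT; exact: continuous_l1norm.
have lip u v : support_max C u - support_max C v <= `|u - v| * l1norm z.
  have [[x Cx <-] _] := support_maxP u cC C0.
  have [_ /(_ x Cx) xv] := support_maxP v cC C0.
  apply: (@le_trans _ _ (dot (u - v) x)); first by rewrite dotBl lerB.
  rewrite (le_trans (ler_norm _))// (le_trans (norm_dot _ _))//.
  by rewrite ler_wpM2l// zM// in_setE.
(* The added [1] keeps the divisor positive when [C] is just the origin. *)
have z1 : 0 < l1norm z + 1 by rewrite ltr_wpDl// sumr_ge0.
move=> u; apply/(@cvgrPdist_le R R^o _ (nbhs u) (nbhs_filter u)) => e e0; near=> v.
have uv : `|u - v| * l1norm z <= e.
  rewrite (@le_trans _ _ (e / (l1norm z + 1) * (l1norm z + 1)))//; last by rewrite divfK ?gt_eqF.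
  rewrite ler_pM ?lerDl// ?sumr_ge0//.
  near: v; apply/nbhs_ballP; exists (e / (l1norm z + 1)); first exact: divr_gt0.
  by move=> v; rewrite -ball_normE => /ltW.
rewrite ler_norml lerNl opprB !(le_trans (lip _ _))//.
by rewrite distrC.
Unshelve. all: by end_near. Qed.

Lemma continuous_support_min C : compact C -> C !=set0 ->
  continuous (support_min C).
Proof.
move=> cC C0 u; apply: (@continuousN _ R^o _ (fun u => support_max C (- u))).
apply: continuous_comp; first exact: opp_continuous.
exact: continuous_support_max.
Qed.

(** [dot u] depends only on the projection to the line of [u]; as the projection of [C] is convex,
    every level between the extremes is attained. *)
Lemma hyperplane_one_convex C u c : u != 0 -> one_convex C -> compact C ->
  C !=set0 -> support_min C u <= c <= support_max C u ->
  hyperplane u c `&` C !=set0.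
Proof.
move=> u0 Cc cC C0; have [[x Cx <-] _] := support_maxP u cC C0.
have [[y Cy <-] _] := support_minP u cC C0 => /andP[yc cx].
have [t [t0 t1 tc]] : exists t, [/\ 0 <= t, t <= 1 & t * dot u x + (1 - t) * dot u y = c].
  have [xy|xy] := eqVneq (dot u x) (dot u y).
    exists 0; split=> //; rewrite mul0r add0r subr0 mul1r; apply/le_anti.
    by rewrite yc -xy cx.
  have xy0 : 0 < dot u x - dot u y.
    by rewrite subr_gt0 lt_def xy (le_trans yc).
  exists ((c - dot u y) / (dot u x - dot u y)); split.
  - by rewrite divr_ge0 ?subr_ge0// ltW// -subr_gt0.
  - by rewrite ler_pdivrMr// mul1r lerB.
  - set t := _ / _; rewrite (mulrBl _ 1) mul1r addrA addrAC -mulrBr.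
    by rewrite divfK ?gt_eqF// subrK.
have := Cc u u0 (line_proj u x) (line_proj u y) (Itv01 t0 t1).
rewrite !in_setE => /(_ _ _)[||z Cz zE]; [by exists x|by exists y|].
exists z; split=> //; rewrite /hyperplane /= -(dot_line_proj _ u0) zE.
by rewrite -tc -(dot_line_proj x u0) -(dot_line_proj y u0) -!dotZr -dotDr.
Qed.

End Support.

(** * Passage to finitely many members *)

Theorem theorem8p1 (R : realType) (n : nat)
    (F : 'I_n.+1 -> set (set 'rV[R]_n))
    (F_1convex : forall i C, F i C -> one_convex C)
    (F_compact : forall i C, F i C -> compact C)
    (F_intersecting : forall i, pairwise_intersecting (F i)) :
  (exists (u : 'rV[R]_n) (c : R), u != 0 /\
     common_transversal u c (\bigcup_(i in setT) F i))
  \/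
  (forall I1 I2 : {set 'I_n.+1},
     I1 != finset.set0 -> I2 != finset.set0 ->
     (I1 :&: I2)%SET = finset.set0 -> (I1 :|: I2)%SET = finset.setT ->
     exists (u : 'rV[R]_n) (c : R) (C : 'I_n.+1 -> set 'rV[R]_n),
       [/\ u != 0,
           (forall i, F i (C i)),
           (forall i, i \in I1 -> C i `<=` pos_side u c) &
           (forall i, i \in I2 -> C i `<=` neg_side u c)]).
Proof.
have F_neq0 i C : F i C -> C !=set0.
  by move=> iC; have [x [Cx _]] := F_intersecting i C C iC iC; exists x.
have F_min_max i C D u : F i C -> F i D -> support_min C u <= support_max D u.
  move=> iC iD; have [x [Cx Dx]] := F_intersecting i C D iC iD.
  apply: le_trans ((support_maxP u (F_compact _ _ iD) (F_neq0 _ _ iD)).2 _ Dx).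
  exact: (support_minP u (F_compact _ _ iC) (F_neq0 _ _ iC)).2.
have [trans|no_trans] := pselect (exists (u : 'rV[R]_n) (c : R), u != 0 /\
  common_transversal u c (\bigcup_(i in setT) F i)); [by left|right].
pose V := ('I_n.+1 * set 'rV[R]_n)%type.
pose D := [set p : V * V | F p.1.1 p.1.2 /\ F p.2.1 p.2.2].
pose G (p : V * V) := [set u | support_max p.2.2 u < support_min p.1.2 u].
have gap u : u != 0 -> exists2 p, D p & G p u.
  move=> u0; apply: contrapT => no_gap; apply: no_trans.
  have min_max i C j E : F i C -> F j E -> support_min C u <= support_max E u.
    move=> iC jE; rewrite leNgt; apply/negP => lt; apply: no_gap.
    by exists ((i, C), (j, E)).
  (* Helly's theorem on the line: the intervals of values of [dot u] meet pairwise, so the supremum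
     of their lower ends lies in all of them. *)
  pose S := [set support_min C u | C in \bigcup_(i in setT) F i].
  exists u, (sup S); split=> // C [i _ iC].
  apply: hyperplane_one_convex => //; [exact: F_1convex iC|exact: F_compact iC|
    exact: F_neq0 iC|].
  have SC : S (support_min C u) by exists C => //; exists i.
  apply/andP; split.
    apply: ub_le_sup => //; exists (support_max C u).
    by move=> _ [E [j _ jE] <-]; exact: min_max jE iC.
  apply: ge_sup; first by exists (support_min C u).
  by move=> _ [E [j _ jE] <-]; exact: min_max jE iC.
have [D' D'D D'cover] : finite_subset_cover D G (@l1sphere R n).
  have := @compact_l1sphere R n; rewrite compact_cover; apply.
    move=> [[i C] [j E]] [/= iC jE].
    have c : continuous (fun u => support_min C u - support_max E u).
      move=> u; apply: (@continuousB R _ _ (support_min C) (support_max E)).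
        exact: continuous_support_min (F_compact _ _ iC) (F_neq0 _ _ iC) _.
      exact: continuous_support_max (F_compact _ _ jE) (F_neq0 _ _ jE) _.
    rewrite (_ : G _ = (fun u => support_min C u - support_max E u) @^-1` [set x | x > 0]).
      by apply: open_comp => [u _|]; [exact: c|exact: open_gt].
    by apply/seteqP; split=> u; rewrite /G /= subr_gt0.
  by move=> u /l1sphere_neq0/gap[p Dp Gp]; exists p.
(* The finite index type for [separation]: a selected pair, with a boolean choosing one of its two
   members. *)
pose mem (k : D' * bool) : V := if k.2 then (val k.1).1 else (val k.1).2.
have memF k : F (mem k).1 (mem k).2.
  by case: k => p b; have [] := set_mem (D'D _ (valP p)); case: b.
move=> I1 I2 I10 I20 I12 I1I2.
have I2E : I2 = (~: I1)%SET.
  apply/finset.setP => i; rewrite inE.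
  move/finset.setP/(_ i) : I12; move/finset.setP/(_ i) : I1I2; rewrite !inE.
  by case: (i \in I1); case: (i \in I2).
have [||||||u [a [u1 uI1 uI2]]] := @separation R n _ (fun k => (mem k).1)
  (fun k => support_min (mem k).2) (fun k => support_max (mem k).2) _ _ _ _ _ I1 I10 _.
- by move=> k; exact: continuous_support_min (F_compact _ _ (memF k)) (F_neq0 _ _ (memF k)).
- by move=> k; exact: continuous_support_max (F_compact _ _ (memF k)) (F_neq0 _ _ (memF k)).
- by move=> k u; rewrite /support_min opprK.
- move=> k l u kl; apply: F_min_max (memF k) _.
  by rewrite kl; exact: memF.
- move=> u /D'cover[p pD' pG]; exists (Sub p pD', true), (Sub p pD', false).
  exact: pG.
- by rewrite -I2E.
have /choice[C CP] : forall i, exists C, F i C /\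
    if i \in I1 then a < support_min C u else support_max C u < a.
  move=> i; case: (boolP (i \in I1)) => [/uI1|/uI2] [k ki ak];
    by exists (mem k).2; split=> //; rewrite -ki.
exists u, a, C; split.
- exact: l1sphere_neq0.
- by move=> i; exact: (CP i).1.
- move=> i iI1 x Cx; have [iC] := CP i; rewrite iI1 => /lt_le_trans; apply.
  exact: (support_minP u (F_compact _ _ iC) (F_neq0 _ _ iC)).2.
- move=> i; rewrite I2E inE => iI1 x Cx; have [iC] := CP i.
  rewrite (negbTE iI1); apply: le_lt_trans.
  exact: (support_maxP u (F_compact _ _ iC) (F_neq0 _ _ iC)).2.
Qed.
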